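(* Let $p\ge 5$ be a prime. (a) There exist infinitely many (pairwise non-isomorphic) $2$-generator finite $p$-groups $G$, and even infinitely many of maximal class, such that $G$ is a Beauville group but $|G^{p^{e-1}}|<p^2$, where $p^e=\exp G$. (b) There exist infinitely many (pairwise non-isomorphic) $2$-generator finite $p$-groups $G$, and even infinitely many of maximal class, such that $|G^{p^{e-1}}|\ge p^2$, where $p^e=\exp G$, but $G$ is not a Beauville group.
   Context: A $2$-generator finite $p$-group is one whose minimal number of generators is $2$. $G^{p^i}$ is the subgroup generated by all $g^{p^i}$, $g\in G$. A $p$-group of order $p^n$ is of maximal class if its nilpotency class is $n-1$. For $x,y\in G$ let $\Sigma(x,y)=\bigcup_{g\in G}\big(\langle x\rangle^g\cup\langle y\rangle^g\cup\langle xy\rangle^g\big)$. A Beauville structure for $G$ is a pair of generating sets $\{x_1,y_1\}$, $\{x_2,y_2\}$ of $G$ such that $\Sigma(x_1,y_1)\cap\Sigma(x_2,y_2)=1$. $G$ is a Beauville group if it has a Beauville structure. *)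

(* Defs.v *)
From mathcomp Require Import all_boot all_fingroup all_solvable.

Set Implicit Arguments.
Unset Strict Implicit.
Unset Printing Implicit Defensive.

Import GroupScope.

Section Beauville.

Variable gT : finGroupType.
Implicit Types (G : {group gT}) (x y : gT) (p : nat).

Definition Sigma G x y : {set gT} :=
  \bigcup_(g in G) (<[x]> :^ g :|: <[y]> :^ g :|: <[x * y]> :^ g).

Definition beauville_structure G (s1 s2 : gT * gT) : Prop :=
  [/\ <<[set s1.1; s1.2]>> = G,
      <<[set s2.1; s2.2]>> = G
    & Sigma G s1.1 s1.2 :&: Sigma G s2.1 s2.2 = 1].

Definition beauville_group G : Prop :=
  exists s1 s2 : gT * gT, beauville_structure G s1 s2.

Definition two_generator_pgroup p G : Prop := p.-group G /\ 'm(G) = 2.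

(* The class is n - 1, written without truncated subtraction, so that the
   trivial group (n = 0, class 0) does not qualify. *)
Definition maximal_class p G : Prop :=
  exists2 n : nat, #|G| = (p ^ n)%N & (nil_class G).+1 = n.

(* For a p-group G, 'Mho^i(G) is the subgroup generated by the p ^ i-th powers
   of the elements of G (lemma MhoE).  The exponent e is determined by G, and
   e > 0 whenever G is nontrivial, so e.-1 is e - 1. *)
Definition small_last_power p G : Prop :=
  exists2 e : nat, exponent G = (p ^ e)%N & #|'Mho^e.-1(G)| < p ^ 2.

Definition large_last_power p G : Prop :=
  exists2 e : nat, exponent G = (p ^ e)%N & p ^ 2 <= #|'Mho^e.-1(G)|.

End Beauville.

Definition infinitely_many_groups
    (P : forall gT : finGroupType, {group gT} -> Prop) : Prop :=
  exists (gT : nat -> finGroupType) (G : forall i : nat, {group gT i}),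
    (forall i, P (gT i) (G i)) /\
    (forall i j, i <> j -> ~ (G i \isog G j)).

(* Main.v *)
Require Import Defs.
From HB Require Import structures.
From mathcomp Require Import all_boot all_fingroup all_algebra all_solvable.

(** Let Z = Z/p^m with m >= 2, and let the cyclic group of order p act by
    translation on the functions f : Z/p -> Z.  Inside the wreath product of
    pairs (f, i) consider the subgroup cut out by

      sum_x f(x) = c i   and   d f(x) independent of x,

    where c and d are killed by p (sum_kernel).  Its functions part A, where
    i = 0, is abelian of index p, and an element of A commuting with a lift s
    of the generator of Z/p is a constant function killed by p, so the centraliser of s in A has order at most p.  This alone
    makes the group of maximal class, generated by s and some a in A
    (maximal_class_of_small_cent): each commutation with s divides the order
    of a subgroup of A by at most p, so |A| = p^n forces a commutator
    [a, s, .., s] with n - 1 entries s to survive, and a p-group with a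
    commutator that long has order at least p^(n+1), the order of the whole
    group.

    The p-th power of an element outside A is the constant sum_x f(x) = c i,
    because translating by multiples of i <> 0 visits every point of Z/p once.
    The two choices of parameters give the two halves of the theorem.

    - c = 0, d = p^(m-1).  Every element outside A has order p.  As p >= 5,
      besides the directions s, a, sa of the Frattini quotient there are three
      more, s a^2, s a^4 and their product, all outside A.  Conjugates of
      cyclic subgroups of different directions, one of them of order p, meet
      trivially (TI_conj_cycles), so this is a Beauville structure.  On the
      other hand the condition on d f says that p^(m-1)-th powers are constant
      functions killed by p, and there are at most p of these.

    - c = p^(m-1), d = 0.  Every element outside A has the central element
      z = constant c among its powers.  A generating pair is not contained in
      A, so z lies in every Sigma(x, y), and there is no Beauville structure.
      But the p^(m-1)-th powers of the functions of sum zero are not all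
      constant, hence not all central, and a noncentral normal subgroup of a
      p-group has order at least p^2.

    In both cases the exponent is p^m, attained on the function that is
    1 - p at 0 and 1 elsewhere, so different m give nonisomorphic groups. *)

Set Implicit Arguments.
Unset Strict Implicit.
Unset Printing Implicit Defensive.

Import GroupScope.
Import GRing.Theory.

(** * p-groups with an abelian maximal subgroup and a small centraliser *)

Section MaxClass.

Variables (gT : finGroupType) (p : nat).
Implicit Types (G A H : {group gT}) (a s x y g h : gT).

Lemma iter_commg_lcn G a s k :
  a \in G -> s \in G -> iter k (fun x => [~ x, s]) a \in 'L_k.+1(G).
Proof. by move=> Ga Gs; elim: k => // k IHk; rewrite iterS lcnSn mem_commg. Qed.

Lemma commg_morph_in A s :
  abelian A -> s \in 'N(A) -> {in A &, {morph (fun x => [~ x, s]) : x y / x * y}}.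
Proof.
move=> cAA nAs x y Ax Ay /=; have Axs z : z \in A -> [~ z, s] \in A.
  by move=> Az; rewrite commgEl groupM ?groupV ?memJ_norm.
by rewrite commMgJ conjgE (centsP cAA _ (Axs x Ax) y Ay) mulKg.
Qed.

(** Commutation with s is an endomorphism of A whose kernel is the
    centraliser of s, so each application divides the order of the image of A
    by at most p, and n applications leave more than one element. *)
Lemma long_commutator A s n :
    prime p -> abelian A -> s \in 'N(A) -> #|'C_A[s]| <= p ->
    #|A| = (p ^ n.+1)%N ->
  exists2 a, a \in A & iter n (fun x => [~ x, s]) a != 1.
Proof.
move=> p_pr cAA nAs leCp oA; set f := fun x => [~ x, s].
pose fm := Morphism (commg_morph_in cAA nAs).
have kerf: 'ker fm \subset 'C_A[s].
  apply/subsetP=> x /morphpreP[Ax /set1P/= fx1].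
  by apply/setIP; split=> //; apply/cent1P/commgP/eqP.
have sfA (B : {group gT}) : B \subset A -> fm @* B \subset A.
  move=> sBA; apply/subsetP=> _ /morphimP[x Ax Bx ->] /=.
  by rewrite commgEl groupM ?groupV ?memJ_norm.
(* B is the k-th iterated image of A; its elements are tracked back to A. *)
have chain k : exists2 B : {group gT}, B \subset A & #|A| <= p ^ k * #|B| /\
    {in B, forall b, exists2 a, a \in A & iter k f a = b}.
  elim: k => [|k [B sBA [leAB liftB]]].
    by exists A => //; rewrite mul1n; split=> // a Aa; exists a.
  exists (fm @* B)%G; first exact: sfA.
  split=> [|_ /morphimP[b _ Bb ->]]; last first.
    by have [a Aa <-] := liftB b Bb; exists a.
  apply: leq_trans leAB _; rewrite expnSr -mulnA leq_mul2l; apply/orP; right.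
  rewrite card_morphim (setIidPr sBA) -(LagrangeI B ('ker fm)).
  rewrite leq_mul2r; apply/orP; right; apply: leq_trans leCp.
  by apply: subset_leq_card; rewrite subIset ?kerf ?orbT.
have [B sBA [leAB liftB]] := chain n.
have /trivgPn[b Bb ntb]: B :!=: 1.
  apply: contraTneq leAB => ->; rewrite cards1 muln1 oA -ltnNge.
  by rewrite ltn_exp2l ?prime_gt1.
by have [a Aa fa] := liftB b Bb; exists a; rewrite ?fa.
Qed.

(** A subgroup containing a and s contains the same commutator, so its class
    exceeds n too; as a p-group of order p^j > p has class at most j - 1, the
    subgroup is already as large as G. *)
Lemma long_commutator_gen G a s n :
    prime p -> p.-group G -> 0 < n -> #|G| = (p ^ n.+2)%N ->
    a \in G -> s \in G -> iter n (fun x => [~ x, s]) a != 1 ->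
  <<[set s; a]>> = G /\ nil_class G = n.+1.
Proof.
move=> p_pr pG n_gt0 oG Ga Gs nt.
have class_gt (H : {group gT}) : H \subset G -> a \in H -> s \in H ->
    n < nil_class H /\ n.+1 < logn p #|H|.
  move=> sHG Ha Hs; have pH := pgroupS sHG pG.
  have lt_n: n < nil_class H.
    rewrite ltnNge; apply: contra nt => /(lcn_nil_classP _ (pgroup_nil pH)) L1.
    by have := iter_commg_lcn n Ha Hs; rewrite L1 inE.
  split=> //; move: (leq_trans lt_n (nil_class_pgroup pH)).
  by rewrite leq_max ltnNge n_gt0 /=; case: (logn _ _).
have [lt_n _] := class_gt G (subxx _) Ga Gs; split; last first.
  apply/eqP; rewrite eqn_leq lt_n andbT.
  apply: leq_trans (nil_class_pgroup pG) _.
  by rewrite oG pfactorK // geq_max /= leqnn.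
have sHG: <<[set s; a]>> \subset G by rewrite gen_subG subUset !sub1set Gs.
have [_] := class_gt [group of <<[set s; a]>>] sHG
  (mem_gen (set22 _ _)) (mem_gen (set21 _ _)) => /= leH.
apply/eqP; rewrite eqEcard sHG oG (card_pgroup (pgroupS sHG pG)).
by rewrite leq_exp2l ?prime_gt1.
Qed.

Lemma maximal_class_of_small_cent G A s :
    prime p -> p.-group G -> abelian A -> A <| G -> #|G : A| = p ->
    p ^ 2 <= #|A| -> s \in G -> #|'C_A[s]| <= p ->
  [/\ maximal_class p G, 'm(G) = 2, ~~ cyclic G
    & exists2 a, a \in A & <<[set s; a]>> = G].
Proof.
move=> p_pr pG cAA nsAG iGA leA Gs leCp.
have [sAG nAG] := andP nsAG; have pA := pgroupS sAG pG.
have [n n_gt0 oA]: exists2 n, 0 < n & #|A| = (p ^ n.+1)%N.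
  move: leA; rewrite (card_pgroup pA) (leq_exp2l _ _ (prime_gt1 p_pr)).
  by case: (logn p #|A|) => // n n_gt0; exists n.
have oG: #|G| = (p ^ n.+2)%N by rewrite -(Lagrange sAG) iGA oA -expnSr.
have [a Aa nt] := long_commutator p_pr cAA (subsetP nAG s Gs) leCp oA.
have [defG clG] := long_commutator_gen p_pr pG n_gt0 oG (subsetP sAG a Aa) Gs nt.
have ncG: ~~ cyclic G.
  by apply/negP=> /cyclic_abelian; rewrite -nil_class1 clG ltnS leqNgt n_gt0.
split=> //; [by exists n.+2; rewrite ?clG | | by exists a].
apply/eqP; rewrite eqn_leq; apply/andP; split.
  rewrite -[in 'm(_)]defG; apply: leq_trans (grank_min _) _.
  by rewrite cards2; case: (_ != _).
have [B defB oB] := grank_witness G; rewrite -oB ltnNge leq_eqVlt ltnS leqn0.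
apply: contra ncG => /orP[/cards1P[x def_x]|]; rewrite -defB.
  by rewrite def_x cycle_cyclic.
by rewrite cards_eq0 => /eqP->; rewrite gen0 cyclic1.
Qed.

End MaxClass.

(** * Directions in the abelianisation and Beauville structures *)

Section Directions.

Variables (gT : finGroupType) (p : nat) (G : {group gT}).
Hypotheses (p_pr : prime p) (pG : p.-group G).
Implicit Types (s a x y g h : gT) (i j k l : nat).

Local Notation cosetG' := (coset G^`(1)).

Let nG'G : G \subset 'N(G^`(1)). Proof. exact: der_norm. Qed.

(** The derived subgroup of a p-group lies in the Frattini subgroup, so its
    elements are nongenerators. *)
Lemma gen_mod_der1 (H : {group gT}) :
  H \subset G -> G / G^`(1) \subset H / G^`(1) -> H :=: G.
Proof.
move=> sHG; rewrite quotientSK // => sGH.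
rewrite -(genGid H); apply: Phi_nongen.
apply/eqP; rewrite eqEsubset join_subG Phi_sub sHG /=.
apply: subset_trans sGH _; rewrite mul_subG ?joing_subr //.
apply: subset_trans (joing_subl _ _).
by rewrite (Phi_joing pG) joing_subl.
Qed.

Lemma coset_der1_conj x g : x \in G -> g \in G -> cosetG' (x ^ g) = cosetG' x.
Proof.
move=> Gx Gg; rewrite morphJ ?(subsetP nG'G) // conjgE.
have cGG := der_abelian 0 G; rewrite derg0 in cGG.
by rewrite (centsP cGG _ (mem_quotient _ Gx) _ (mem_quotient _ Gg)) mulKg.
Qed.

Lemma quotient_der1_sub x y (K : {group coset_of G^`(1)}) :
    <<[set x; y]>> = G -> cosetG' x \in K -> cosetG' y \in K ->
  G / G^`(1) \subset K.
Proof.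
move=> defG Kx Ky; rewrite sub_quotient_pre //.
suffices: <<[set x; y]>> \subset cosetG' @*^-1 K by rewrite defG.
have [Gx Gy]: x \in G /\ y \in G by rewrite -defG !mem_gen ?set21 ?set22.
by rewrite gen_subG subUset !sub1set !mem_morphpre ?(subsetP nG'G).
Qed.

(** Conjugation is invisible in G / G', so the hypothesis makes the image of x
    generate the abelianisation, and a nilpotent group with cyclic
    abelianisation is cyclic. *)
Lemma cyclic_of_conj_mem x y g h :
    g \in G -> h \in G -> <<[set x; y]>> = G -> y ^ h \in <[x ^ g]> -> cyclic G.
Proof.
move=> Gg Gh defG /cycleP[k def_yh].
apply: (cyclic_nilpotent_quo_der1_cyclic (pgroup_nil pG)).
have [Gx Gy]: x \in G /\ y \in G by rewrite -defG !mem_gen ?set21 ?set22.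
suffices ->: G / G^`(1) = <[cosetG' x]> by exact: cycle_cyclic.
apply/eqP; rewrite eqEsubset cycle_subG mem_quotient // andbT.
apply: (quotient_der1_sub defG); first exact: cycle_id.
have Gxg: x ^ g \in G by rewrite groupJ.
rewrite -(coset_der1_conj Gy Gh) def_yh morphX ?(subsetP nG'G) //.
by rewrite /= coset_der1_conj ?mem_cycle.
Qed.

(** Cramer's rule in the abelianisation: writing D for the determinant
    i l - j k, the D-th powers of the images of s and a are combinations of
    those of x and y, and D-th roots exist because D is prime to p. *)
Lemma gen_of_det s a x y i j k l :
    <<[set s; a]>> = G -> x \in G -> y \in G ->
    cosetG' x = cosetG' s ^+ i * cosetG' a ^+ j ->
    cosetG' y = cosetG' s ^+ k * cosetG' a ^+ l ->
    coprime p (i * l - j * k) ->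
  <<[set x; y]>> = G.
Proof.
move=> defG Gx Gy cx cy cop.
have [Gs Ga]: s \in G /\ a \in G by rewrite -defG !mem_gen ?set21 ?set22.
set H := <<_>>; have sHG: H \subset G by rewrite gen_subG subUset !sub1set Gx.
apply: (@gen_mod_der1 [group of H]) => //=.
have cGG := der_abelian 0 G; rewrite derg0 in cGG.
set u := cosetG' s in cx cy; set v := cosetG' a in cx cy.
have [Qu Qv]: u \in G / G^`(1) /\ v \in G / G^`(1) by rewrite !mem_quotient.
have cuv : commute u v by apply: (centsP cGG).
have cuvX m n : commute (u ^+ m) (v ^+ n) by apply/commuteX2.
have [Hx Hy]: cosetG' x \in H / G^`(1) /\ cosetG' y \in H / G^`(1).
  by rewrite !mem_quotient ?mem_gen ?set21 ?set22.
have lejk: j * k <= i * l.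
  rewrite leqNgt; apply/negP=> /ltnW; rewrite -subn_eq0 => /eqP e0.
  by move: cop; rewrite e0 /coprime gcdn0; case: (p) p_pr => [|[]].
have root w : w \in G / G^`(1) -> w ^+ (i * l - j * k) \in H / G^`(1) ->
    w \in H / G^`(1).
  move=> Qw Hw; have: generator <[w]> (w ^+ (i * l - j * k)).
    rewrite generator_coprime; have := mem_p_elt (quotient_pgroup _ pG) Qw.
    by case/p_natP=> // e ->; rewrite coprimeXl.
  by move/eqP=> ew; rewrite -cycle_subG ew cycle_subG.
have Hu: u \in H / G^`(1).
  apply: root => //.
  suffices ->: u ^+ (i * l - j * k) = cosetG' x ^+ l * (cosetG' y ^+ j)^-1.
    by rewrite groupM ?groupV ?groupX.
  apply: (mulIg (cosetG' y ^+ j)); rewrite mulgKV cx cy !expgMn // -!expgM.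
  by rewrite mulgA -expgD (mulnC k) subnK // (mulnC l).
have Hv: v \in H / G^`(1).
  apply: root => //.
  suffices ->: v ^+ (i * l - j * k) = cosetG' y ^+ i * (cosetG' x ^+ k)^-1.
    by rewrite groupM ?groupV ?groupX.
  apply: (mulIg (cosetG' x ^+ k)); rewrite mulgKV cx cy !expgMn // -!expgM.
  by rewrite mulgA -cuvX -mulgA -expgD subnK // (mulnC l) (mulnC k).
exact: (@quotient_der1_sub s a (H / G^`(1))).
Qed.

(** A nontrivial intersection would contain all of the second subgroup, which
    has prime order, so a conjugate of y would be a power of one of x. *)
Lemma TI_conj_cycles x y g h :
    ~~ cyclic G -> <<[set x; y]>> = G -> y ^+ p = 1 -> g \in G -> h \in G ->
  <[x]> :^ g :&: <[y]> :^ h = 1.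
Proof.
move=> ncG defG yp1 Gg Gh.
have [-> | nty] := eqVneq y 1; first by rewrite cycle1 conjs1g setIg1.
rewrite -!cycleJ setIC prime_TIg //.
  by rewrite -orderE orderJ (nt_prime_order p_pr yp1 nty).
by rewrite cycle_subG; apply: contra ncG; apply: cyclic_of_conj_mem.
Qed.

(** The pairs (i, j) with image s^i a^j in the abelianisation are (1, 0),
    (0, 1), (1, 1) on one side and (1, 2), (1, 4), (2, 6) on the other.  All
    the determinants between the two sides are 1, 2, 3, 4 or 6 up to sign,
    prime to every p >= 5, so a member of one triple and a member of the other
    always generate G. *)
Lemma beauville_of_order_p s a :
    5 <= p -> ~~ cyclic G -> <<[set s; a]>> = G ->
    (s * a ^+ 2) ^+ p = 1 -> (s * a ^+ 4) ^+ p = 1 ->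
    (s * a ^+ 2 * (s * a ^+ 4)) ^+ p = 1 ->
  beauville_group G.
Proof.
move=> p_ge5 ncG defG o1 o2 o3.
have [Gs Ga]: s \in G /\ a \in G by rewrite -defG !mem_gen ?set21 ?set22.
have cop n : 0 < n < 7 -> n != 5 -> coprime p n.
  move=> n_lt7 n_ne5; rewrite prime_coprime //; apply/negP=> p_dv_n.
  have := prime_gt1 p_pr; have: p <= n by apply: dvdn_leq; case/andP: n_lt7.
  move: n_lt7 n_ne5 p_dv_n p_pr p_ge5.
  by do 7?[case: n => [|n] //]; case: (p) => [|[|[|[|[|[|[|?]]]]]]].
have mcoset x y : x \in G -> y \in G -> cosetG' (x * y) = cosetG' x * cosetG' y.
  by move=> Gx Gy; rewrite morphM ?(subsetP nG'G).
have Xcoset x n : x \in G -> cosetG' (x ^+ n) = cosetG' x ^+ n.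
  by move=> Gx; rewrite morphX ?(subsetP nG'G).
have cus : commute (cosetG' a) (cosetG' s).
  have cGG := der_abelian 0 G; rewrite derg0 in cGG.
  by apply: (centsP cGG); rewrite mem_quotient.
have Gsa n : s * a ^+ n \in G by rewrite groupM ?groupX.
have csa n : cosetG' (s * a ^+ n) = cosetG' s ^+ 1 * cosetG' a ^+ n.
  by rewrite mcoset ?Xcoset ?groupX.
have csa2 : cosetG' (s * a ^+ 2 * (s * a ^+ 4)) = cosetG' s ^+ 2 * cosetG' a ^+ 6.
  rewrite mcoset // !csa !expg1 mulgA -(mulgA (cosetG' s)).
  rewrite (commute_sym (commuteX 2 (commute_sym cus))).
  by rewrite !expgS !expg0 !mulg1 -!mulgA.
have gen_dir x y i j k l := @gen_of_det s a x y i j k l defG.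
have dirT1 : {in [:: s; a; s * a], forall x, x \in G /\ exists ij : nat * nat,
    cosetG' x = cosetG' s ^+ ij.1 * cosetG' a ^+ ij.2 /\
    ij \in [:: (1, 0); (0, 1); (1, 1)]%N}.
  move=> x; rewrite !inE => /or3P[]/eqP->.
  - by split=> //; exists (1, 0)%N; rewrite mulg1.
  - by split=> //; exists (0, 1)%N; rewrite mul1g.
  by split; [rewrite groupM | exists (1, 1)%N; rewrite mcoset].
have dirT2 : {in [:: s * a ^+ 2; s * a ^+ 4; s * a ^+ 2 * (s * a ^+ 4)],
    forall y, [/\ y \in G, y ^+ p = 1 & exists kl : nat * nat,
    cosetG' y = cosetG' s ^+ kl.1 * cosetG' a ^+ kl.2 /\
    kl \in [:: (1, 2); (1, 4); (2, 6)]%N]}.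
  move=> y; rewrite !inE => /or3P[]/eqP->.
  - by split=> //; exists (1, 2)%N.
  - by split=> //; exists (1, 4)%N.
  by split; [rewrite groupM | | exists (2, 6)%N].
have genT12 x y : x \in [:: s; a; s * a] ->
    y \in [:: s * a ^+ 2; s * a ^+ 4; s * a ^+ 2 * (s * a ^+ 4)] ->
    <<[set x; y]>> = G.
  move=> /dirT1[Gx [[i j] [/= cx ij]]] /dirT2[Gy _ [[k l] [/= cy kl]]].
  (* The determinant is a difference of natural numbers, so it is positive in
     only one of the two orders of x and y. *)
  have := gen_dir _ _ _ _ _ _ Gx Gy cx cy.
  have := gen_dir _ _ _ _ _ _ Gy Gx cy cx; rewrite setUC.
  move: ij kl; rewrite !inE => /or3P[]/eqP[-> ->] /or3P[]/eqP[-> ->];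
   by move=> gyx gxy; first [apply: gxy; exact: cop | apply: gyx; exact: cop].
exists (s, a), (s * a ^+ 2, s * a ^+ 4); split=> //.
  exact: (gen_dir (s * a ^+ 2) (s * a ^+ 4) 1%N 2 1%N 4 _ _ _ _ (cop 2 isT isT)).
have one_in x y : 1 \in Sigma G x y.
  by apply/bigcupP; exists 1; rewrite ?group1 // !inE !conjsg1 group1.
apply/eqP; rewrite eqEsubset sub1set [1 \in _]inE !one_in; apply/andP; split=> //.
apply/subsetP=> u /setIP[/bigcupP[g Gg ug] /bigcupP[h Gh uh]].
have [x T1x ux]: exists2 x, x \in [:: s; a; s * a] & u \in <[x]> :^ g.
  by move: ug; rewrite !inE -orbA => /or3P[] ux;
    [exists s | exists a | exists (s * a)]; rewrite ?inE ?eqxx ?orbT.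
have [y T2y uy]: exists2 y,
    y \in [:: s * a ^+ 2; s * a ^+ 4; s * a ^+ 2 * (s * a ^+ 4)] &
    u \in <[y]> :^ h.
  by move: uh; rewrite !inE -orbA => /or3P[] uy;
    [exists (s * a ^+ 2) | exists (s * a ^+ 4)
    | exists (s * a ^+ 2 * (s * a ^+ 4))];
    rewrite ?inE ?eqxx ?orbT.
have [_ yp1 _] := dirT2 y T2y.
by rewrite -(TI_conj_cycles ncG (genT12 x y T1x T2y) yp1 Gg Gh) inE ux.
Qed.

(** A generating pair is not contained in A, so one of its members has z as a
    power, and z lies in every Sigma. *)
Lemma not_beauville_of_common_power (A : {group gT}) z :
    A \proper G -> z != 1 -> (forall x, x \in G -> x \notin A -> z \in <[x]>) ->
  ~ beauville_group G.
Proof.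
move=> /properP[_ [w Gw nAw]] ntz zin [s1 [s2 [gen1 gen2]]].
have zS t : <<[set t.1; t.2]>> = G -> z \in Sigma G t.1 t.2.
  move=> defG.
  have [Gt1 Gt2]: t.1 \in G /\ t.2 \in G by rewrite -defG !mem_gen ?set21 ?set22.
  apply/bigcupP; exists 1; rewrite ?group1 // !conjsg1 !inE -orbA.
  have [At1 | /(zin _ Gt1)-> //] := boolP (t.1 \in A).
  have [At2 | /(zin _ Gt2)-> //] := boolP (t.2 \in A); last by rewrite orbT.
  case/negP: nAw; apply: (subsetP _ w Gw); rewrite -[G : {set _}]defG.
  by rewrite gen_subG subUset !sub1set At1.
move/setP/(_ z); rewrite in_setI !zS // inE => /esym/eqP z1.
by rewrite z1 eqxx in ntz.
Qed.

End Directions.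

(** * The wreath product of a finite abelian group by Z/p *)

Definition wreath (V : finZmodType) (p : nat) : Type :=
  ({ffun 'Z_p -> V} * 'Z_p)%type.

Section WreathGroup.

Variables (V : finZmodType) (p : nat).
Local Notation W := (wreath V p).
Local Open Scope ring_scope.

HB.instance Definition _ := Finite.on W.

Definition wreath_mul (u v : W) : W :=
  ([ffun x => u.1 x + v.1 (x + u.2)], u.2 + v.2).
Definition wreath_one : W := ([ffun=> 0], 0).
Definition wreath_inv (u : W) : W := ([ffun x => - u.1 (x - u.2)], - u.2).

Fact wreath_mulA : associative wreath_mul.
Proof.
move=> u v w; congr (_, _); rewrite /= ?addrA //.
by apply/ffunP=> x; rewrite !ffunE /= !addrA.
Qed.

Fact wreath_mul1 : left_id wreath_one wreath_mul.
Proof.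
case=> f i; congr (_, _); rewrite ?add0r //.
by apply/ffunP=> x; rewrite !ffunE add0r addr0.
Qed.

Fact wreath_mulV : left_inverse wreath_one wreath_inv wreath_mul.
Proof.
move=> u; congr (_, _); rewrite ?addNr //.
by apply/ffunP=> x; rewrite !ffunE addNr.
Qed.

HB.instance Definition _ :=
  Finite_isGroup.Build W wreath_mulA wreath_mul1 wreath_mulV.

End WreathGroup.

Section Wreath.

Variables (V : finZmodType) (p : nat).
Local Notation W := (wreath V p).
Implicit Types (u w : W) (f : {ffun 'Z_p -> V}) (n : nat).
Local Open Scope ring_scope.

Definition wconst (v : V) : W := ([ffun=> v], 0).

Lemma wmulE u w : (u * w)%g = ([ffun x => u.1 x + w.1 (x + u.2)], u.2 + w.2).
Proof. by []. Qed.

Lemma woneE : 1%g = ([ffun=> 0], 0) :> W.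
Proof. by []. Qed.

Lemma wexpE u n :
  (u ^+ n)%g = ([ffun x => \sum_(k < n) u.1 (x + u.2 *+ k)], u.2 *+ n).
Proof.
elim: n => [|n IHn].
  by rewrite expg0 woneE; congr (_, _); apply/ffunP=> x; rewrite !ffunE big_ord0.
rewrite expgSr IHn wmulE /= mulrSr; congr (_, _).
by apply/ffunP=> x; rewrite !ffunE big_ord_recr.
Qed.

Lemma wexp_base f n : (((f, 0) : W) ^+ n)%g = ([ffun x => f x *+ n], 0).
Proof.
rewrite wexpE /= mul0rn; congr (_, _); apply/ffunP=> x; rewrite !ffunE.
rewrite (eq_bigr (fun=> f x)) ?sumr_const ?card_ord // => k _.
by rewrite mul0rn addr0.
Qed.

Lemma wconstX v n : (wconst v ^+ n)%g = wconst (v *+ n).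
Proof. by rewrite wexp_base; congr (_, _); apply/ffunP=> x; rewrite !ffunE. Qed.

Lemma wconst_inj : injective wconst.
Proof. by move=> v w [/ffunP/(_ 0)]; rewrite !ffunE. Qed.

End Wreath.

Lemma unit_Zp_prime p (i : 'Z_p) : prime p -> i != 0%R -> (i \is a GRing.unit)%R.
Proof.
move=> p_pr i_neq0; have p_gt1 := prime_gt1 p_pr.
rewrite -(natr_Zp i) unitZpE // prime_coprime //.
apply: contra i_neq0 => /dvdnP[n def_i]; rewrite -val_eqE /= def_i.
have := ltn_ord i; rewrite def_i [X in (_ < X)%N -> _]Zp_cast //.
by case: n {def_i} => // n; rewrite ltnNge mulSn leq_addr.
Qed.

(** If i <> 0 in Z/p, the points x + i k with k < p run once through Z/p. *)
Lemma wexp_prime (V : finZmodType) p (u : wreath V p) :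
  prime p -> u.2 != 0%R -> u ^+ p = wconst p (\sum_x u.1 x)%R.
Proof.
move=> p_pr nzu; have Uu := unit_Zp_prime p_pr nzu.
case: u => f i in nzu Uu *; rewrite wexpE /=; congr (_, _); last first.
  by rewrite -mulr_natl pchar_Zp ?mul0r ?prime_gt1.
apply/ffunP=> x; rewrite !ffunE.
case: p p_pr f i nzu Uu x => [|[|n]] // p_pr f i nzu Uu x.
have inj_h : injective (fun k : 'Z_n.+2 => x + i *+ k)%R.
  move=> k l /addrI; rewrite -!(mulr_natr i) !natr_Zp; exact: mulrI.
by rewrite [RHS](reindex_inj inj_h).
Qed.

(** * The subgroups cut out by the sum *)

Section SumKernel.

(** The hypotheses on V and e describe a cyclic group of order p ^ k.+2 with
    generator e through its torsion. *)
Variables (V : finZmodType) (p k : nat) (e c : V) (d : nat).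
Hypotheses (p_pr : prime p) (p_ge5 : 5 <= p).
Hypothesis V_exp : forall v : V, (v *+ (p ^ k.+2) = 0)%R.
Hypothesis V_tors : #|[set v : V | v *+ p == 0]%R| <= p.
Hypothesis e_order : (e *+ (p ^ k.+1) != 0)%R.
Hypotheses (cp0 : (c *+ p = 0)%R) (cd0 : (c *+ d = 0)%R).
Hypothesis dp0 : forall v : V, (v *+ (d * p) = 0)%R.

Local Notation W := (wreath V p).
Local Open Scope ring_scope.
Implicit Types (u w : W).

Let p_gt1 : (1 < p)%N := prime_gt1 p_pr.

(** The parameter c decides whether the extension by Z/p splits: a nonzero c is
    a common p-th power outside the functions.  The parameter d bounds the size
    of the last power subgroup: with d = p ^ k.+1 it leaves only constants
    there, with d = 0 it imposes nothing. *)
Definition sum_kernel_set : {set W} :=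
  [set u : W | (\sum_x u.1 x == c *+ u.2)
             && [forall x, u.1 x *+ d == u.1 0 *+ d]].

Lemma sum_kernelP u :
  reflect (\sum_x u.1 x = c *+ u.2 /\ forall x y, u.1 x *+ d = u.1 y *+ d)
  (u \in sum_kernel_set).
Proof.
rewrite inE; apply: (iffP andP) => [[/eqP-> /forallP cst]|[-> cst]].
  by split=> // x y; rewrite (eqP (cst x)) (eqP (cst y)).
by split=> //; apply/forallP=> x; apply/eqP.
Qed.

Fact sum_kernel_group_set : group_set sum_kernel_set.
Proof.
apply/group_setP; split.
  apply/sum_kernelP; rewrite woneE /= mulr0n; split=> [|x y]; rewrite ?ffunE //.
  by rewrite big1 // => x _; rewrite ffunE.
move=> u w /sum_kernelP[su du] /sum_kernelP[sw dw]; apply/sum_kernelP.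
split=> [|x y]; last first.
  by rewrite !ffunE !mulrnDl (du x y) (dw _ (y + u.2)).
rewrite (eq_bigr (fun x => u.1 x + w.1 (x + u.2))); last first.
  by move=> x _; rewrite ffunE.
rewrite big_split /= su -(reindex_inj (addIr u.2) (P := xpredT) (F := w.1)) sw.
rewrite -mulrnDr [X in (_ %% X)%N]Zp_cast //.
by rewrite {1}(divn_eq (u.2 + w.2) p) mulrnDr mulnC mulrnA cp0 mul0rn add0r.
Qed.

Definition sum_kernel : {group W} := Group sum_kernel_group_set.

Fact snd_morph : {in sum_kernel &, {morph (fun u : W => u.2) : u w / (u * w)%g}}.
Proof. by []. Qed.

(** Its kernel is the subgroup of functions, called base below. *)
Definition shift_part := Morphism snd_morph.
Definition base : {group W} := ('ker shift_part)%G.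

Lemma baseP u : reflect (u \in sum_kernel /\ u.2 = 0) (u \in base).
Proof.
apply: (iffP idP) => [/morphpreP[Gu /set1P]|[Gu u0]]; first by [].
by apply/morphpreP; split=> //; apply/set1P.
Qed.

Let cardsT_Zp : #|'Z_p| = p. Proof. by rewrite card_ord Zp_cast. Qed.

Let nz2 : (1 + 1 : 'Z_p) != 0.
Proof. by rewrite -val_eqE /= Zp_cast // !modn_small //; apply: leq_trans p_ge5. Qed.

(** Second component 1 forces the sum c; putting it at a single point is the
    simplest choice. *)
Definition shift_lift : W := ([ffun x => c *+ (x == 0)], 1).

(** The sum of e over Z/p is e *+ p, which is taken off at the point 0. *)
Definition max_order_elt : W := ([ffun x => e - e *+ p *+ (x == 0)], 0).

Lemma shift_lift_in : shift_lift \in sum_kernel.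
Proof.
apply/sum_kernelP; split=> [|x y]; last first.
  by rewrite !ffunE -!mulrnA ![(_ * d)%N]mulnC !mulrnA cd0 !mul0rn.
rewrite (bigD1 0) //= big1 ?ffunE ?eqxx ?addr0 => [|x /negPf nzx].
  by rewrite modn_small ?mulr1n.
by rewrite ffunE nzx.
Qed.

Lemma max_order_elt_in : max_order_elt \in base.
Proof.
apply/baseP; split=> //; apply/sum_kernelP; split=> [|x y] /=; last first.
  have dpb (b : bool) : e *+ p *+ b *+ d = 0.
    by rewrite -!mulrnA mulnCA mulnC (mulnC p) mulrnA dp0 mul0rn.
  by rewrite !ffunE !mulrnBl !dpb.
rewrite (eq_bigr _ (fun x _ => ffunE _ x)) sumrB sumr_const cardsT_Zp.
rewrite (bigD1 0) //= big1 => [|x /negPf->]; last by rewrite mulr0n.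
by rewrite addr0 mulr1n subrr mulr0n.
Qed.

Lemma sum_kernel_exp_outside u :
  u \in sum_kernel -> u.2 != 0 -> (u ^+ p)%g = wconst p (c *+ u.2).
Proof. by move=> /sum_kernelP[su _] nzu; rewrite wexp_prime // su. Qed.

(** Outside base the order divides p ^ 2, which is at most the exponent of V. *)
Lemma sum_kernel_exponent_dvd : (exponent sum_kernel %| p ^ k.+2)%N.
Proof.
apply/exponentP=> u Gu; have [u0|nzu] := eqVneq u.2 0.
  rewrite [u]surjective_pairing u0 wexp_base woneE; congr (_, _).
  by apply/ffunP=> x; rewrite !ffunE V_exp.
rewrite !expnS expgM sum_kernel_exp_outside // expgM wconstX -mulrnA mulnC.
by rewrite mulrnA cp0 mul0rn wconstX mul0rn.
Qed.

Lemma sum_kernel_pgroup : p.-group sum_kernel.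
Proof.
by rewrite -pnat_exponent (pnat_dvd sum_kernel_exponent_dvd) // pnatX pnat_id.
Qed.

Lemma sub_base : base \subset sum_kernel.
Proof. by apply/subsetP=> u /baseP[]. Qed.

Lemma max_order_elt_exp : (max_order_elt ^+ (p ^ k.+1))%g = wconst p (e *+ p ^ k.+1).
Proof.
rewrite wexp_base; congr (_, _); apply/ffunP=> x; rewrite !ffunE mulrnBl.
case: (x == 0); first by rewrite mulr1n -[e *+ p *+ _]mulrnA -expnS V_exp subr0.
by rewrite mulr0n mul0rn subr0.
Qed.

Lemma exponent_sub (H : {group W}) :
  max_order_elt \in H -> H \subset sum_kernel -> exponent H = (p ^ k.+2)%N.
Proof.
move=> He sHG.
have /(dvdn_pfactor _ _ p_pr)[j lej def_j]: (exponent H %| p ^ k.+2)%N.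
  exact: dvdn_trans (exponentS sHG) sum_kernel_exponent_dvd.
rewrite def_j; congr (_ ^ _)%N; apply/eqP; rewrite eqn_leq lej ltnNge.
apply: contra e_order => lejk.
have: (max_order_elt ^+ (p ^ k.+1))%g = 1%g.
  by apply: (exponentP _ _ He); rewrite def_j dvdn_exp2l.
by rewrite max_order_elt_exp -[1%g]/(wconst p 0) => /wconst_inj->.
Qed.

Lemma sum_kernel_exponent : exponent sum_kernel = (p ^ k.+2)%N.
Proof. exact: exponent_sub (subsetP sub_base _ max_order_elt_in) (subxx _). Qed.

Lemma base_abelian : abelian base.
Proof.
apply/centsP=> u /baseP[_ u0] w /baseP[_ w0]; rewrite /commute !wmulE u0 w0.
by congr (_, _); apply/ffunP=> x; rewrite !ffunE !addr0 addrC.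
Qed.

(** Commuting with shift_lift means invariance under translation by 1. *)
Lemma cent_shift_lift_const u :
  u.2 = 0 -> commute u shift_lift -> u = wconst p (u.1 0).
Proof.
move=> u0; rewrite /commute !wmulE u0 => /(congr1 fst)/ffunP cus.
rewrite [LHS]surjective_pairing u0; congr (_, _).
have shift x : u.1 (x + 1) = u.1 x.
  have := cus x; rewrite !ffunE addr0 [RHS]addrC => /addIr->//.
apply/ffunP=> x; rewrite ffunE -(natr_Zp x).
by elim: (x : nat) => [|j IHj]; rewrite ?mulrSr ?shift.
Qed.

Lemma card_consts : (#|[set wconst p v | v : V & (v *+ p == 0)%R]| <= p)%N.
Proof. by apply: leq_trans (leq_imset_card _ _) _. Qed.

(** A constant function v has sum v *+ p, which must vanish. *)
Lemma const_tors v : wconst p v \in sum_kernel -> v *+ p = 0.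
Proof.
case/sum_kernelP; rewrite (eq_bigr (fun=> v)) ?sumr_const ?cardsT_Zp //.
by move=> x _; rewrite ffunE.
Qed.

Lemma card_cent_shift_lift : (#|'C_base[shift_lift]| <= p)%N.
Proof.
apply: leq_trans card_consts; apply: subset_leq_card.
apply/subsetP=> u /setIP[/baseP[Gu u0] /cent1P cus].
have def_u := cent_shift_lift_const u0 cus.
by apply/imsetP; exists (u.1 0); rewrite ?inE // const_tors // -def_u.
Qed.

Lemma base_normal : base <| sum_kernel.
Proof. exact: ker_normal. Qed.

Lemma base_index : #|sum_kernel : base| = p.
Proof.
rewrite -{1}(setIid sum_kernel) -(card_morphim shift_part sum_kernel).
rewrite -[RHS]cardsT_Zp -cardsT.
congr #|pred_of_set _|; apply/setP=> i; rewrite inE; apply/morphimP.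
by exists (shift_lift ^+ i)%g; rewrite ?groupX ?shift_lift_in //= wexpE /= natr_Zp.
Qed.

Lemma sum_kernel_max_class :
  [/\ maximal_class p sum_kernel, 'm(sum_kernel)%g = 2%N, ~~ cyclic sum_kernel
    & exists2 a, a \in base & (<<[set shift_lift; a]>> = sum_kernel)%g].
Proof.
apply: (maximal_class_of_small_cent p_pr sum_kernel_pgroup base_abelian base_normal
  base_index _ shift_lift_in card_cent_shift_lift).
apply: leq_trans (dvdn_leq (cardG_gt0 _) (exponent_dvdn _)).
by rewrite (exponent_sub max_order_elt_in sub_base) leq_exp2l.
Qed.

Lemma sum_kernel_beauville : c = 0 -> beauville_group sum_kernel.
Proof.
move=> c0; have [_ _ ncG [a /baseP[Ga a0] defG]] := sum_kernel_max_class.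
have Gs := shift_lift_in.
have outside u : u \in sum_kernel -> u.2 != 0 -> (u ^+ p = 1)%g.
  by move=> Gu nzu; rewrite sum_kernel_exp_outside // c0 mul0rn.
have snd_sa n : (shift_lift * a ^+ n)%g.2 = 1.
  by rewrite /= wexpE /= a0 mul0rn addr0.
apply: (beauville_of_order_p p_pr sum_kernel_pgroup p_ge5 ncG defG); apply: outside;
  rewrite ?groupM ?groupX ?snd_sa ?oner_neq0 //.
by rewrite snd_morph ?snd_sa ?groupM ?groupX.
Qed.

(** The p ^ k.+1-th powers lie in the centraliser of shift_lift in base: those
    of elements outside base are trivial, and those of elements of base are
    constant by the choice of d. *)
Lemma sum_kernel_small : c = 0 -> (forall v : V, v *+ d = v *+ p ^ k.+1) ->
  small_last_power p sum_kernel.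
Proof.
move=> c0 dE; exists k.+2; rewrite ?sum_kernel_exponent //=.
rewrite (MhoE _ sum_kernel_pgroup).
apply: (@leq_ltn_trans p); last by rewrite -{1}(expn1 p) ltn_exp2l.
suffices: <<[set u ^+ (p ^ k.+1) | u in sum_kernel]>>%g \subset 'C_base[shift_lift].
  by move/subset_leq_card/leq_trans; apply; apply: card_cent_shift_lift.
rewrite gen_subG; apply/subsetP=> _ /imsetP[u Gu ->].
have [u0 | nzu] := eqVneq u.2 0; last first.
  by rewrite expnS expgM sum_kernel_exp_outside // c0 mul0rn expg1n group1.
apply/setIP; split; first by rewrite groupX //; apply/baseP.
have [_ du] := sum_kernelP _ Gu.
apply/cent1P; rewrite [u]surjective_pairing u0 wexp_base /commute !wmulE.
congr (_, _); last by rewrite addrC.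
by apply/ffunP=> x; rewrite !ffunE /= addr0 addrC -!dE (du _ x).
Qed.

(** An element outside base with second component i has the constant c *+ i
    as its p-th power, and i is invertible modulo p. *)
Lemma sum_kernel_not_beauville : c != 0 -> ~ beauville_group sum_kernel.
Proof.
move=> nzc; apply: (@not_beauville_of_common_power _ _ base (wconst p c)).
- rewrite properEneq sub_base andbT; apply: contraTneq p_gt1 => eqG.
  by rewrite -base_index -eqG indexgg.
- by apply: contra nzc => /eqP; rewrite -[1%g]/(wconst p 0) => /wconst_inj->.
move=> u Gu nAu; have nzu: u.2 != 0.
  by apply: contra nAu => /eqP u0; apply/baseP.
pose j := u.2^-1; have := divrr (unit_Zp_prime p_pr nzu); rewrite -/j.
move=> /(congr1 val)/=; rewrite ![X in (_ %% X)%N]Zp_cast //.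
rewrite (@modn_small 1) // => e1.
suffices ->: wconst p c = (u ^+ (p * j))%g by apply: mem_cycle.
rewrite expgM sum_kernel_exp_outside // wconstX -mulrnA; congr (wconst p _).
by rewrite (divn_eq (u.2 * j) p) e1 mulrnDr mulnC mulrnA cp0 mul0rn add0r.
Qed.

(** The witness w takes the values e at 1 and - e at 0; its p ^ k.+1-th power
    takes different values at 1 and 2, so it does not commute with shift_lift.
    The intersection with the centre is thus a proper subgroup of the subgroup
    of these powers, and it is nontrivial because that subgroup is normal. *)
Lemma sum_kernel_large : (forall v : V, v *+ d = 0) -> large_last_power p sum_kernel.
Proof.
move=> d0; exists k.+2; rewrite ?sum_kernel_exponent // -[k.+2.-1]/k.+1.
pose f : {ffun 'Z_p -> V} := [ffun x => e *+ (x == 1) - e *+ (x == 0)].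
pose w : W := (f, 0); set M := 'Mho^k.+1(sum_kernel)%G.
have sum1 i : \sum_(x : 'Z_p) e *+ (x == i) = e.
  by rewrite (bigD1 i) //= eqxx big1 ?addr0 // => x /negPf->.
have Gw : w \in sum_kernel.
  apply/sum_kernelP; split=> [|x y] /=; last by rewrite !d0.
  by rewrite (eq_bigr _ (fun x _ => ffunE _ x)) sumrB !sum1 subrr.
have Mw : (w ^+ (p ^ k.+1))%g \in M.
  by rewrite Mho_p_elt // (mem_p_elt sum_kernel_pgroup).
have nsMG : M <| sum_kernel := char_normal (Mho_char _ _).
have pM : p.-group M := pgroupS (normal_sub nsMG) sum_kernel_pgroup.
have nZw : (w ^+ (p ^ k.+1))%g \notin 'Z(sum_kernel)%g.
  apply: contra e_order => /centerP[_ /(_ _ shift_lift_in)].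
  rewrite wexp_base => /cent_shift_lift_const -/(_ erefl) /(congr1 fst)/ffunP cst.
  (* The points 1 and 1 + 1 are distinct and both differ from 0. *)
  have := cst (1 + 1); have := cst 1; rewrite !ffunE /= => <-.
  have /negPf-> : (1 + 1 : 'Z_p) != 1 by rewrite -subr_eq0 addrK oner_neq0.
  by rewrite (negPf nz2) !mulr0n subrr mul0rn subr0 mulr1n => <-.
have pZ : p.-group (M :&: 'Z(sum_kernel))%g := pgroupS (subsetIl _ _) pM.
have ltZM : (#|M :&: 'Z(sum_kernel)%g| < #|M|)%N.
  rewrite proper_card // properEneq subsetIl andbT.
  by apply: contraNneq nZw => defM; move: Mw; rewrite -defM => /setIP[].
have ntZ : (M :&: 'Z(sum_kernel) != 1)%g.
  apply: meet_center_nil (pgroup_nil sum_kernel_pgroup) nsMG _.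
  by apply: contraTneq Mw => ->; apply: contra nZw => /set1P->; rewrite group1.
rewrite (card_pgroup pM) (leq_exp2l _ _ p_gt1).
rewrite (card_pgroup pM) (card_pgroup pZ) (ltn_exp2l _ _ p_gt1) in ltZM.
apply: leq_trans ltZM; rewrite ltnS lt0n; apply: contra ntZ.
by move=> /eqP log0; rewrite trivg_card1 (card_pgroup pZ) log0.
Qed.

End SumKernel.

(** * Cyclic coefficients and the two families *)

Section CyclicCoefficients.
Variables (p k : nat).
Hypothesis p_pr : prime p.
Local Notation V := ('Z_(p ^ k.+2)).
Local Open Scope ring_scope.

Let q_gt1 : (1 < p ^ k.+2)%N.
Proof. by rewrite -{1}(expn0 p) ltn_exp2l // prime_gt1. Qed.

Lemma Zq_natr_eq0 n : ((n%:R : V) == 0) = (p ^ k.+2 %| n)%N.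
Proof. by rewrite -val_eqE /= val_Zp_nat. Qed.

Lemma Zq_exp (v : V) : v *+ p ^ k.+2 = 0.
Proof. by rewrite -mulr_natr pchar_Zp ?mulr0. Qed.

Lemma Zq_one_order : (1 : V) *+ p ^ k.+1 != 0.
Proof. by rewrite Zq_natr_eq0 dvdn_Pexp2l ?prime_gt1 // ltnn. Qed.

Lemma Zq_tors : (#|[set v : V | (v *+ p == 0)%R]| <= p)%N.
Proof.
have p_gt0 := prime_gt0 p_pr.
apply: leq_trans (_ : #|[set ((p ^ k.+1 * j)%:R : V) | j : 'I_p]| <= p)%N; last first.
  by apply: leq_trans (leq_imset_card _ _) _; rewrite card_ord.
apply: subset_leq_card; apply/subsetP=> v; rewrite inE -{1}(natr_Zp v) -mulrnA.
rewrite Zq_natr_eq0 [X in (X %| _)%N]expnSr dvdn_pmul2r // => /dvdnP[j def_v].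
have ltjp : (j < p)%N.
  have := ltn_ord v; rewrite [X in (_ < X)%N]Zp_cast // def_v [X in (_ < X)%N]expnS.
  by rewrite ltn_pmul2r ?expn_gt0 ?p_gt0.
by apply/imsetP; exists (Ordinal ltjp) => //=; rewrite mulnC -def_v natr_Zp.
Qed.

End CyclicCoefficients.

Section Families.

Variables (p : nat) (p_pr : prime p) (p_ge5 : 5 <= p) (k : nat).
Local Notation V := ('Z_(p ^ k.+2)).

Let e : V := 1%R.
Let c : V := (e *+ p ^ k.+1)%R.

Let mulp0 (v : V) : (v *+ (p ^ k.+1 * p) = 0)%R.
Proof. by rewrite -expnSr Zq_exp. Qed.

Let cp0 : (c *+ p = 0)%R.
Proof. by rewrite -mulrnA mulp0. Qed.

Definition split_family : {group wreath V p} :=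
  sum_kernel (p ^ k.+1) p_pr (mul0rn V p).
Definition twisted_family : {group wreath V p} := sum_kernel 0 p_pr cp0.

Lemma split_familyP :
  [/\ two_generator_pgroup p split_family, maximal_class p split_family,
      beauville_group split_family & small_last_power p split_family]
  /\ exponent split_family = (p ^ k.+2)%N.
Proof.
have vexp := Zq_exp p_pr (k := k); have tors := Zq_tors k p_pr.
have ord1 := Zq_one_order k p_pr.
have [mc m2 _ _] :=
  sum_kernel_max_class p_pr vexp tors ord1 (mul0rn V p) (mul0rn V _) mulp0.
split; last exact: (sum_kernel_exponent p_pr vexp ord1).
split=> //; first by split=> //; apply: (sum_kernel_pgroup _ _ vexp).
- exact: (sum_kernel_beauville p_pr p_ge5 vexp tors ord1 _ (mul0rn V _)).
- exact: (sum_kernel_small p_pr vexp tors ord1).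
Qed.

Lemma twisted_familyP :
  [/\ two_generator_pgroup p twisted_family, maximal_class p twisted_family,
      large_last_power p twisted_family & ~ beauville_group twisted_family]
  /\ exponent twisted_family = (p ^ k.+2)%N.
Proof.
have vexp := Zq_exp p_pr (k := k); have tors := Zq_tors k p_pr.
have ord1 := Zq_one_order k p_pr.
have d0 (v : V) : (v *+ (0 * p) = 0)%R by [].
have [mc m2 _ _] := sum_kernel_max_class p_pr vexp tors ord1 cp0 (mulr0n c) d0.
split; last exact: (sum_kernel_exponent p_pr vexp ord1).
split=> //; first by split=> //; apply: (sum_kernel_pgroup _ _ vexp).
- exact: (sum_kernel_large p_pr p_ge5 vexp ord1 _ (mulr0n c)).
- exact: sum_kernel_not_beauville.
Qed.

End Families.

(** The exponent is an isomorphism invariant, so it separates the members. *)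
Lemma infinitely_many_of_exponent p
    (P : forall gT : finGroupType, {group gT} -> Prop)
    (gT : nat -> finGroupType) (G : forall i, {group gT i}) :
    1 < p -> (forall i, P (gT i) (G i)) ->
    (forall i, exponent (G i) = (p ^ i.+2)%N) ->
  infinitely_many_groups P.
Proof.
move=> p_gt1 PG expG; exists gT, G; split=> // i j neq_ij isoG; apply: neq_ij.
have := exponent_isog isoG; rewrite !expG => /eqP.
by rewrite eqn_exp2l // => /eqP[].
Qed.

Lemma infinitely_many_sub (P Q : forall gT : finGroupType, {group gT} -> Prop) :
    (forall gT (G : {group gT}), P gT G -> Q gT G) ->
  infinitely_many_groups P -> infinitely_many_groups Q.
Proof.
by move=> sPQ [gT [G [PG nisoG]]]; exists gT, G; split=> // i; apply: sPQ.
Qed.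

Theorem corollary2p12 (p : nat) (p_prime : prime p) (p_ge5 : 5 <= p) :
  ((infinitely_many_groups (fun gT G =>
      [/\ two_generator_pgroup p G,
          beauville_group G
        & small_last_power p G]))
   /\
   (infinitely_many_groups (fun gT G =>
      [/\ two_generator_pgroup p G,
          maximal_class p G,
          beauville_group G
        & small_last_power p G])))
  /\
  ((infinitely_many_groups (fun gT G =>
      [/\ two_generator_pgroup p G,
          large_last_power p G
        & ~ beauville_group G]))
   /\
   (infinitely_many_groups (fun gT G =>
      [/\ two_generator_pgroup p G,
          maximal_class p G,
          large_last_power p G
        & ~ beauville_group G]))).
Proof.
have p_gt1 := prime_gt1 p_prime.
have sm : infinitely_many_groups (fun gT G => [/\ two_generator_pgroup p G,
    maximal_class p G, beauville_group G & small_last_power p G]).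
  by apply: (@infinitely_many_of_exponent p _ _ (split_family p_prime)) => // i;
    case: (split_familyP p_prime p_ge5 i).
have lg : infinitely_many_groups (fun gT G => [/\ two_generator_pgroup p G,
    maximal_class p G, large_last_power p G & ~ beauville_group G]).
  by apply: (@infinitely_many_of_exponent p _ _ (twisted_family p_prime)) => // i;
    case: (twisted_familyP p_prime p_ge5 i).
split; split=> //.
  by apply: infinitely_many_sub sm => gT G [].
by apply: infinitely_many_sub lg => gT G [].
Qed.
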